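(* Let $n\ge 2$, let $F:\mathbf{R}^n\to\mathbf{R}$ be an integrand, and let $\gamma\in \mathrm{AC}([0,1];\mathbf{R}^n)$ be regular. Set $\hat v:=\gamma(1)-\gamma(0)$ and let $\overline{x}\in K_F$ be such that $\|\hat v\|_F=\langle \hat v,\overline{x}\rangle$. Then the following are equivalent: (1) $\gamma$ is an $F$-geodesic; (2) $\mathfrak{L}_F(\gamma)=\|\hat v\|_F$; (3) for almost every $t\in(0,1)$, $\dot\gamma(t)\in \mathrm{Cont}(F)$ and $\overline{x}+(\dot\gamma(t))^\perp$ is a supporting hyperplane for $K_F$ at $\overline{x}$.
   Context: $\mathbb{S}^{n-1}$ is the unit sphere in $\mathbf{R}^n$. A function $F:\mathbf{R}^n\to\mathbf{R}$ is 1-homogeneous if $F(\lambda x)=\lambda F(x)$ for all $\lambda\ge0$, $x\in\mathbf{R}^n$; it is positive if $F>0$ on $\mathbb{S}^{n-1}$. An integrand is a lower semicontinuous, 1-homogeneous, positive function. $\mathrm{AC}([0,1];\mathbf{R}^n)$ is the set of absolutely continuous $\gamma:[0,1]\to\mathbf{R}^n$; $\gamma$ is regular if $|\dot\gamma(t)|>0$ for a.e. $t$. The $F$-length is $\mathfrak{L}_F(\gamma)=\int_0^1F(\dot\gamma(t))\,dt$. $\gamma$ is an $F$-geodesic if it minimizes $\mathfrak{L}_F$ among all $\rho\in\mathrm{AC}([0,1];\mathbf{R}^n)$ with $\rho(0)=\gamma(0)$, $\rho(1)=\gamma(1)$. The $F$-crystal is $K_F:=\bigcap_{v\in\mathbb{S}^{n-1}}\{x:\langle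 x,v\rangle\le F(v)\}$ (a compact convex set with $0$ in its interior). For $\Omega\subseteq\mathbf{R}^n$, its polar body is $\mathfrak{P}\Omega:=\{z:\langle z,x\rangle\le1\ \forall x\in\Omega\}$. For $z\in\mathbf{R}^n$, $\|z\|_F:=\min\{\lambda\ge0: z\in\lambda\,\mathfrak{P}K_F\}$; for every $z$ there is $\overline{x}\in K_F$ with $\langle z,\overline{x}\rangle=\|z\|_F$. Define operators on integrands: $\mathcal{W}(F)(v):=\inf_{w\in\mathbb{S}^{n-1},\langle v,w\rangle>0} F(w)/\langle v,w\rangle$ and $\mathcal{A}(G)(v):=\sup_{w\in\mathbb{S}^{n-1}} G(w)\langle v,w\rangle$ for $v\in\mathbb{S}^{n-1}$, extended to $\mathbf{R}^n$ by 1-homogeneity, and the convex envelope $\mathcal{D}(F):=\mathcal{A}(\mathcal{W}(F))$. The contact set is $\mathrm{Cont}(F):=\{x\in\mathbf{R}^n: F(x)=\mathcal{D}(F)(x)\}$. For a compact $K$ and $v\in\mathbb{S}^{n-1}$, the supporting hyperplane of $K$ associated with $v$ is $\{z:\langle z,v\rangle=\max_{y\in K}\langle y,v\rangle\}$; ''$\overline{x}+u^\perp$ is a supporting hyperplane for $K_F$'' (with $u\neq0$) means $\overline{x}+u^\perp$ equals the supporting hyperplane of $K_F$ associated with $u/|u|$. *)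

(* Defs.v *)
(* R^n is modelled by row vectors 'rV[R]_n over
   an arbitrary R : realType; the Euclidean inner product and norm are
   defined explicitly (MathComp's own norm on matrices is the sup norm). *)
From HB Require Import structures.
From mathcomp Require Import all_boot all_order all_algebra.
From mathcomp Require Import all_classical all_reals all_analysis.
Set Implicit Arguments. Unset Strict Implicit. Unset Printing Implicit Defensive.
Import Order.TTheory GRing.Theory Num.Theory.
Import numFieldNormedType.Exports.
Local Open Scope classical_set_scope.
Local Open Scope ring_scope.

Section Defs.
Context {R : realType} {n : nat}.
Notation vec := 'rV[R]_n.

Definition dotp (x y : vec) : R := \sum_(i < n) x ord0 i * y ord0 i.
Definition enorm (x : vec) : R := Num.sqrt (dotp x x).
Definition sphere : set vec := [set v | enorm v = 1].

Definition homogeneous1 (F : vec -> R) :=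
  forall (l : R) (x : vec), 0 <= l -> F (l *: x) = l * F x.
Definition positive_on_sphere (F : vec -> R) := forall v, sphere v -> 0 < F v.
Definition integrand (F : vec -> R) :=
  lower_semicontinuous (fun x => (F x)%:E) /\ homogeneous1 F /\
  positive_on_sphere F.

Definition hom_ext (f : vec -> R) (x : vec) : R :=
  if x == 0 then 0 else enorm x * f ((enorm x)^-1 *: x).

(* the operators W, A and the convex envelope D *)
Definition Wop (F : vec -> R) : vec -> R :=
  hom_ext (fun v => inf [set F w / dotp v w | w in [set w | sphere w /\ 0 < dotp v w]]).
Definition Aop (G : vec -> R) : vec -> R :=
  hom_ext (fun v => sup [set G w * dotp v w | w in sphere]).
Definition Dop (F : vec -> R) : vec -> R := Aop (Wop F).
Definition Cont (F : vec -> R) : set vec := [set x | F x = Dop F x].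

Definition crystal (F : vec -> R) : set vec :=
  [set x | forall v, sphere v -> dotp x v <= F v].
Definition polar (Om : set vec) : set vec :=
  [set z | forall x, Om x -> dotp z x <= 1].
Definition normF (F : vec -> R) (z : vec) : R :=
  inf [set l : R | 0 <= l /\ exists2 y, polar (crystal F) y & z = l *: y].

Definition supp_hyperplane (K : set vec) (v : vec) : set vec :=
  [set z | dotp z v = sup [set dotp y v | y in K]].
Definition is_supp_hyperplane (K : set vec) (xbar u : vec) :=
  u != 0 /\
  [set z | dotp (z - xbar) u = 0] = supp_hyperplane K ((enorm u)^-1 *: u).

Definition AC01 (g : R -> vec) :=
  forall e : R, 0 < e -> exists2 d : R, 0 < d &
    forall (k : nat) (a b : 'I_k -> R),
      (forall i, 0 <= a i /\ a i <= b i /\ b i <= 1) ->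
      (forall i j, i != j -> b i <= a j \/ b j <= a i) ->
      \sum_(i < k) (b i - a i) < d ->
      \sum_(i < k) enorm (g (b i) - g (a i)) < e.

Definition vel (g : R -> vec) : R -> vec := derive1 g.

Definition regular (g : R -> vec) :=
  {ae (@lebesgue_measure R), forall t, 0 < t < 1 -> vel g t != 0}.

Definition I01 : set R := [set t : R | 0 <= t <= 1].

Definition lengthF (F : vec -> R) (g : R -> vec) : \bar R :=
  (\int[@lebesgue_measure R]_(t in I01) (F (vel g t))%:E)%E.

Definition geodesic (F : vec -> R) (g : R -> vec) :=
  forall r : R -> vec, AC01 r -> r 0 = g 0 -> r 1 = g 1 ->
    (lengthF F g <= lengthF F r)%E.

End Defs.

(* Main.v *)
(* Let [h_K] be the support function of the crystal [K] of [F]. Since [Wop F] is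
   the radial function of [K], the envelope [Dop F] equals [h_K], and [normF F]
   is [h_K] as well; for [xbar] in [K] one has [<v, xbar> <= Dop F v <= F v].

   Integrating [<vel r, xbar> <= F (vel r)] along an absolutely continuous curve
   [r] with the endpoints of [g] gives [normF F (g 1 - g 0) <= lengthF F r], with
   equality iff [F (vel r) = <vel r, xbar>] a.e., which is the contact and
   supporting hyperplane condition. This needs the fundamental theorem of
   calculus for absolutely continuous functions, obtained by splitting the
   function into two nondecreasing ones by total variation, whose Stieltjes
   measures are dominated by Lebesgue measure, and then applying Radon-Nikodym
   and Lebesgue differentiation.

   Conversely, the infimum of [F u_1 + ... + F u_m] over all decompositions
   [v = u_1 + ... + u_m] is sublinear in [v] and below [F], so by Hahn-Banach it
   is attained at [v] by a linear functional, i.e. by a point of [K]. Hence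
   polygonal curves have length arbitrarily close to [normF F v]. *)
Require Import Defs.
From HB Require Import structures.
From mathcomp Require Import all_boot all_order all_algebra.
From mathcomp Require Import all_classical all_reals all_analysis.
From mathcomp Require Import measurable_realfun ring lra.
Set Implicit Arguments.
Unset Strict Implicit.
Unset Printing Implicit Defensive.
Import Order.TTheory GRing.Theory Num.Theory.
Import numFieldNormedType.Exports.
Local Open Scope classical_set_scope.
Local Open Scope ring_scope.

(** * Absolutely continuous functions of one variable *)

Section absolutely_continuous.
Context {R : realType}.
Implicit Types (a b x d e : R) (f : R -> R) (p q : R * R) (s t : seq (R * R)) (l : seq R).

Definition nonoverlap p q := (p.2 <= q.1) || (q.2 <= p.1).

Definition itv_family s := all (fun p => p.1 <= p.2) s && pairwise nonoverlap s.

(** Families are sequences of pairs, so an interval can be traded for the steps of a partition by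
    concatenation; the wide inequality in [e] survives suprema. *)
Definition acfun f := forall e : R, 0 < e -> exists2 d : R, 0 < d &
  forall s, itv_family s -> \sum_(p <- s) (p.2 - p.1) < d ->
    \sum_(p <- s) `|f p.2 - f p.1| <= e.

Lemma nonoverlapC : symmetric nonoverlap.
Proof. by move=> p q; rewrite /nonoverlap orbC. Qed.

Definition steps a (l : seq R) := zip (a :: l) l.

Lemma steps_cons a x l : steps a (x :: l) = (a, x) :: steps x l.
Proof. by []. Qed.

Lemma path_le_last a l : path <%O a l -> a <= last a l.
Proof.
by elim: l a => //= x l ih a /andP[ax /ih xl]; exact: le_trans (ltW ax) xl.
Qed.

Lemma steps_family a l : path <%O a l ->
  itv_family (steps a l) /\ {in steps a l, forall p, a <= p.1 /\ p.2 <= last a l}.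
Proof.
elim: l a => [|x l ih] a; first by [].
move=> /= /andP[ax pl].
have [/andP[h1 h2] h3] := ih _ pl.
split; last first.
  move=> p; rewrite inE => /orP[/eqP ->|/h3[xp pl']] /=.
    by split => //; exact: path_le_last.
  by split => //; exact: le_trans (ltW ax) xp.
rewrite /itv_family /= h1 h2 (ltW ax) !andbT /=.
by apply/allP => p /h3[xp _]; rewrite /nonoverlap /= xp.
Qed.

Lemma sum_steps a l : \sum_(p <- steps a l) (p.2 - p.1) = last a l - a.
Proof.
elim: l a => [|x l ih] a; first by rewrite big_nil subrr.
by rewrite steps_cons big_cons ih /=; ring.
Qed.

Lemma variation_steps a b f l : variation a b f l = \sum_(p <- steps a l) `|f p.2 - f p.1|.
Proof.
rewrite /variation; elim: l a => [|x l ih] a; first by rewrite big_geq // big_nil.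
by rewrite steps_cons [RHS]big_cons -ih [size _]/= big_nat_recl.
Qed.

(** By induction on [s], with [t] arbitrary: a total variation is a supremum over partitions, and
    the steps of a partition of the head interval can be moved into [t] without changing total
    length or creating overlaps. *)
Lemma total_variation_family f e d s t :
  (forall s, itv_family s -> \sum_(p <- s) (p.2 - p.1) < d ->
    \sum_(p <- s) `|f p.2 - f p.1| <= e) ->
  itv_family (s ++ t) -> \sum_(p <- s ++ t) (p.2 - p.1) < d ->
  (\sum_(p <- s) total_variation p.1 p.2 f + (\sum_(p <- t) `|f p.2 - f p.1|)%:E <= e%:E)%E.
Proof.
move=> fed; elim: s t => [|[a b] s ih] t fst sst.
  by rewrite big_nil add0e lee_fin; exact: fed.
have ab : a <= b by move: fst => /andP[/= /andP[]].
have fst' : itv_family (s ++ t).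
  by move: fst; rewrite /itv_family /= => /andP[/andP[_ ->] /andP[_ ->]].
have sst' : \sum_(p <- s ++ t) (p.2 - p.1) < d.
  by move: sst; rewrite big_cons /= => /(le_lt_trans _); apply; rewrite lerDr subr_ge0.
have s0 : (0 <= \sum_(p <- s) total_variation p.1 p.2 f)%E.
  rewrite big_seq; apply: sume_ge0 => p ps; apply: total_variation_ge0.
  by move: fst' => /andP[/allP h _]; apply: h; rewrite mem_cat ps.
have sfin : (\sum_(p <- s) total_variation p.1 p.2 f)%E \is a fin_num.
  rewrite ge0_fin_numE //; apply: le_lt_trans (ltry e).
  apply: le_trans (ih t fst' sst'); rewrite leeDl // lee_fin.
  exact: sumr_ge0.
rewrite big_cons /= -addeA -leeBrDr ?fin_numD ?sfin //.
apply: ge_ereal_sup => _ [_ [l [pl /eqP lb] <-] <-].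
rewrite leeBrDr ?fin_numD ?sfin // addeCA.
rewrite -EFinD variation_steps -big_cat /=.
have [/andP[l1 l2] l3] := steps_family pl.
apply: ih.
  move: fst; rewrite /itv_family /= !all_cat !pairwise_cat !allrel_catr.
  move=> /andP[/and3P[_ -> ->] /andP[/andP[as_ at_] /and3P[-> -> ->]]].
  rewrite l1 l2 /= !andbT.
  (* An interval that does not overlap [(a, b)] overlaps no step of a partition of it. *)
  have sub u : all (nonoverlap (a, b)) u -> all (fun q => all (nonoverlap q) u) (steps a l).
    move=> /allP h; apply/allP => q /l3 [aq]; rewrite lb => qb.
    apply/allP => r /h; rewrite /nonoverlap /= => /orP[br|ra].
      by rewrite (le_trans qb br).
    by rewrite (le_trans ra aq) orbT.
  apply/andP; split; last exact: sub.
  by rewrite allrelC; under eq_allrel do rewrite nonoverlapC; exact: sub.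
move: sst; rewrite big_cons /= !big_cat /= sum_steps lb.
by apply: le_lt_trans; rewrite le_eqVlt; apply/orP; left; apply/eqP; ring.
Qed.

End absolutely_continuous.

(** * Total variation and Jordan decomposition *)

Section ac_decomposition.
Context {R : realType}.
Implicit Types (a b x y d e : R) (f g : R -> R) (s : seq (R * R)).
Notation TV := total_variation.

Lemma itv_family_map g s : {homo g : x y / x <= y} -> itv_family s ->
  itv_family [seq (g p.1, g p.2) | p <- s].
Proof.
move=> gh /andP[/allP h1 h2]; apply/andP; split.
  by apply/allP => _ /mapP[p /h1 ? ->] /=; exact: gh.
rewrite pairwise_map; apply: sub_pairwise h2 => p q /=.
by rewrite /nonoverlap /= => /orP[] /gh ->; rewrite ?orbT.
Qed.

Lemma acfun_comp f g : {homo g : x y / x <= y} ->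
  (forall x y, x <= y -> g y - g x <= y - x) -> acfun f -> acfun (f \o g).
Proof.
move=> gh g1 acf e e0; have [d d0 H] := acf e e0; exists d => // s fs sd.
have := H _ (itv_family_map gh fs); rewrite !big_map; apply.
apply: le_lt_trans sd; rewrite big_seq [leRHS]big_seq; apply: ler_sum => p ps.
by apply: g1; case/andP: fs => /allP /(_ _ ps).
Qed.

Lemma acfunD f g : acfun f -> acfun g -> acfun (f \+ g).
Proof.
move=> acf acg e e0; have e20 : 0 < e / 2 by rewrite divr_gt0.
have [d d0 H] := acf _ e20; have [d' d'0 H'] := acg _ e20.
exists (Num.min d d'); first by rewrite lt_min d0.
move=> s fs; rewrite lt_min => /andP[sd sd'].
rewrite [leRHS]splitr; apply: le_trans (lerD (H s fs sd) (H' s fs sd')).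
rewrite -big_split; apply: ler_sum => p _ /=.
apply: le_trans (ler_normD _ _); rewrite le_eqVlt; apply/orP; left; apply/eqP.
by congr `|_|; ring.
Qed.

Lemma acfunN f : acfun f -> acfun (\- f).
Proof.
move=> acf e /acf[d d0 H]; exists d => // s fs sd.
apply: le_trans (H s fs sd); apply: ler_sum => p _ /=.
by rewrite -opprD normrN.
Qed.

Lemma acfun_total_variation f e : acfun f -> 0 < e -> exists2 d, 0 < d &
  forall s, itv_family s -> \sum_(p <- s) (p.2 - p.1) < d ->
    (\sum_(p <- s) TV p.1 p.2 f <= e%:E)%E.
Proof.
move=> acf /acf[d d0 H]; exists d => // s fs sd.
have := @total_variation_family _ f e d s [::] H.
by rewrite cats0 big_nil adde0; apply.
Qed.

Lemma itv_family1 a b : a <= b -> itv_family [:: (a, b)].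
Proof. by move=> ab; rewrite /itv_family /= ab. Qed.

(** Intervals shorter than [d] have variation at most 1, and finitely many steps of length [d / 2]
    reach from [a] beyond [b]. *)
Lemma acfun_fin_num_tv f a b : acfun f -> a <= b -> TV a b f \is a fin_num.
Proof.
move=> acf ab; have [d d0 H] := acfun_total_variation acf ltr01.
have small x y : x <= y -> y - x < d -> (TV x y f < +oo)%E.
  move=> xy xyd; have := H _ (itv_family1 xy); rewrite !big_seq1 => /(_ xyd).
  by move/le_lt_trans; apply; rewrite ltry.
have fink (k : nat) : (TV a (a + d / 2 * k%:R) f < +oo)%E.
  elim: k => [|k ih]; first by rewrite mulr0 addr0 total_variationxx.
  have k1 : a <= a + d / 2 * k%:R by rewrite lerDl mulr_ge0 // divr_ge0 ?ltW.
  have k2 : a + d / 2 * k%:R <= a + d / 2 * k.+1%:R.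
    by rewrite lerD2l ler_pM2l ?divr_gt0 // ler_nat.
  rewrite (total_variationD f k1 k2) lte_add_pinfty //; apply: small => //.
  rewrite -[k.+1%:R]natr1; lra.
rewrite ge0_fin_numE ?total_variation_ge0 //.
pose k := Num.bound ((b - a) / (d / 2)).
have bk : b <= a + d / 2 * k%:R.
  rewrite -lerBlDl mulrC -ler_pdivrMr ?divr_gt0 //.
  have k0 : 0 <= (b - a) / (d / 2) by rewrite !divr_ge0 ?subr_ge0 // ltW.
  exact: ltW (archi_boundP k0).
apply: le_lt_trans (fink k).
by rewrite (total_variationD f ab bk) leeDl // total_variation_ge0.
Qed.

(* The Jordan decomposition: [phi] is the total variation from [0]. *)
Lemma acfun_decomposition f : acfun f -> exists phi psi : R -> R,
  [/\ acfun phi, acfun psi, nondecreasing phi, nondecreasing psi &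
      forall x, 0 <= x -> f x = phi x - psi x].
Proof.
(* Freezing the argument at 0 on the negative half-line makes the variation from 0 a nondecreasing
   function on the whole line, as a Stieltjes function must be. *)
move=> acf; pose c x := Num.max 0 x.
have ch : {homo c : x y / x <= y}.
  by move=> x y xy; rewrite /c ge_max !le_max lexx xy orbT.
have c0 x : 0 <= c x by rewrite /c le_max lexx.
have c1 x y : x <= y -> c y - c x <= y - x.
  by move=> xy; rewrite /c; case: (ltP 0 x) => h1; case: (ltP 0 y) => h2; lra.
pose V x := fine (TV 0 (c x) f).
have VB x y : x <= y -> V y - V x = fine (TV (c x) (c y) f).
  move=> xy; rewrite /V (total_variationD f (c0 x) (ch _ _ xy)).
  by rewrite fineD ?acfun_fin_num_tv ?ch // addrC addKr.
have Vf x y : x <= y -> `|f (c y) - f (c x)| <= V y - V x.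
  move=> xy; rewrite VB // -lee_fin fineK ?acfun_fin_num_tv ?ch //.
  exact/total_variation_ge/ch.
have acV : acfun V.
  move=> e e0; have [d d0 H] := acfun_total_variation acf e0.
  exists d => // s fs sd; rewrite -lee_fin.
  apply: le_trans (H _ (itv_family_map ch fs) _); last first.
    apply: le_lt_trans sd; rewrite big_map.
    rewrite big_seq [leRHS]big_seq; apply: ler_sum => p ps.
    by apply: c1; case/andP: fs => /allP /(_ _ ps).
  rewrite big_map -sumEFin big_seq [leRHS]big_seq; apply: lee_sum => p ps.
  have p12 : p.1 <= p.2 by case/andP: fs => /allP /(_ _ ps).
  rewrite ger0_norm ?VB // ?fineK ?acfun_fin_num_tv ?ch //=.
  by rewrite fine_ge0 // total_variation_ge0 // ch.
exists V, (V \- (f \o c)); split => //.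
- by apply: acfunD => //; apply: acfunN; exact: acfun_comp.
- by move=> x y xy; rewrite -subr_ge0 (le_trans _ (Vf _ _ xy)).
- move=> x y xy; have := le_trans (ler_norm _) (Vf _ _ xy); rewrite /=; lra.
- by move=> x x0 /=; rewrite /c (max_idPr x0); ring.
Qed.

End ac_decomposition.

(** * Domination of Stieltjes measures by Lebesgue measure *)

Section ac_density.
Context {R : realType}.
Implicit Types (a b x y d e : R) (f g : R -> R) (s : seq (R * R)).
Notation lambda := (@lebesgue_measure R).

Lemma acfun_continuous f : acfun f -> continuous f.
Proof.
move=> acf x; apply/cvgrPdist_le => e e0; have [d d0 H] := acf _ e0.
near=> y.
have xyd : `|x - y| < d by near: y; exact: cvgr_dist_lt.
case: (leP x y) => xy; last move: (ltW xy) => {}xy.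
  have := H _ (itv_family1 xy); rewrite !big_seq1 distrC => /=; apply.
  by rewrite distrC ger0_norm ?subr_ge0 // in xyd.
have := H _ (itv_family1 xy); rewrite !big_seq1 => /=; apply.
by rewrite ger0_norm ?subr_ge0 // in xyd.
Unshelve. all: by end_near. Qed.

Lemma stieltjes_oc (phi : cumulative R R) a b : a <= b ->
  lebesgue_stieltjes_measure phi `]a, b]%classic = (phi b - phi a)%:E.
Proof.
move=> ab; rewrite /lebesgue_stieltjes_measure /measure_extension.
by rewrite measurable_mu_extE/= ?wlength_itv_bnd //; exact: is_ocitv.
Qed.

Lemma stieltjes_oo (phi : cumulative R R) a b : a <= b ->
  (lebesgue_stieltjes_measure phi `]a, b[%classic <= (phi b - phi a)%:E)%E.
Proof.
move=> ab; rewrite -stieltjes_oc //.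
apply: le_measure; rewrite ?inE; [exact: measurable_itv|exact: measurable_itv|].
exact: subset_itvW.
Qed.

(** Gives endpoints to the components of an open set. Only an empty [X] has [inf X = sup X], and
    then both are 0 by the default value of [inf] and [sup]. *)
Lemma open_interval_itvoo (X : set R) : open X -> is_interval X ->
  X `<=` `]0, 2[%classic ->
  [/\ X = `]inf X, sup X[%classic, 0 <= inf X, inf X <= sup X &
      inf X = sup X -> inf X = 0].
Proof.
move=> oX iX X2.
have lb0 : lbound X 0 by move=> x /X2 /=; rewrite in_itv /= => /andP[/ltW].
have lbX : has_lbound X by exists 0.
have ubX : has_ubound X.
  by exists 2 => x /X2 /=; rewrite in_itv /= => /andP[_ /ltW].
have Xe : X = `]inf X, sup X[%classic.
  by rewrite -[LHS](proj1 (interior_id X) oX) interval_bounded_interior //.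
split=> //; have [->|/set0P X0] := eqVneq X set0; rewrite ?inf0 ?sup0 //.
- exact: lb_le_inf.
- by case: X0 => x Xx; apply: (@le_trans _ _ x); [exact: ge_inf|exact: ub_le_sup].
- case: X0 => x Xx e; have : `]inf X, sup X[%classic x by rewrite -Xe.
  by rewrite /= in_itv /= => /andP[ix xs]; have := lt_trans ix xs; rewrite e ltxx.
Qed.

(** An empty interval [(a, a)] is disjoint from everything, yet could sit inside [(c, d)]; the
    hypotheses pin empty intervals to 0, to the left of all others. Two nonempty ones that overlap
    share the midpoint [m]. *)
Lemma itvoo_nonoverlap a b c d : a <= b -> c <= d -> 0 <= a -> 0 <= c ->
  (a = b -> a = 0) -> (c = d -> c = 0) ->
  `]a, b[%classic `&` `]c, d[%classic = set0 -> nonoverlap (a, b) (c, d).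
Proof.
move=> ab cd a0 c0 ab0 cd0 disj; rewrite /nonoverlap /=.
case: (leP b c) => //= bc; case: (leP d a) => //= da; exfalso.
have [ab'|cd'] : a < b \/ a = b by move: ab; rewrite le_eqVlt => /orP[/eqP|]; auto.
  have [cd'|/[dup]/cd0 c0' cd'] : c < d \/ c = d.
      by move: cd; rewrite le_eqVlt => /orP[/eqP|]; auto.
    pose m := (Num.max a c + Num.min b d) / 2.
    suff : (`]a, b[%classic `&` `]c, d[%classic) m by rewrite disj.
    rewrite /m /= !in_itv /=.
    by case: (leP a c) => h1; case: (leP b d) => h2; split; apply/andP; split; lra.
  by lra.
by have := ab0 cd'; lra.
Qed.

(** Outer regularity puts the null set in an open set of Lebesgue measure below [d]. Any finitely
    many of its components form an admissible family, so their Stieltjes masses sum to at most [e],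
    and the bound passes to the limit. *)
Lemma stieltjes_dominated (phi : cumulative R R) e d (N : set (measurableTypeR R)) :
  (forall s, itv_family s -> \sum_(p <- s) (p.2 - p.1) < d ->
    \sum_(p <- s) `|phi p.2 - phi p.1| <= e) -> 0 < d ->
  measurable N -> N `<=` `]0, 1]%classic -> lambda N = 0%E ->
  (lebesgue_stieltjes_measure phi N <= e%:E)%E.
Proof.
move=> H d0 mN N01 N0.
have lN : (lambda N < +oo)%E by rewrite N0 ltry.
have [U0 [oU0 NU0 lU0]] := lebesgue_regularity_outer mN lN d0.
(* This bounds the components, so that [inf] and [sup] are their endpoints; the right end exceeds 1
   because [N] may contain 1. *)
pose U := U0 `&` `]0, 2[%classic.
have oU : open U by apply: openI => //; exact: interval_open.
have mU : measurable (U : set (measurableTypeR R)).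
  exact: open_measurable.
have mU0 : measurable (U0 : set (measurableTypeR R)).
  exact: open_measurable.
have NU : N `<=` U.
  move=> x Nx; split; first exact: NU0.
  have := N01 _ Nx; rewrite /= !in_itv /= => /andP[->] /le_lt_trans; apply.
  by rewrite ltr1n.
have lU : (lambda U < d%:E)%E.
  apply: le_lt_trans lU0.
  apply: (@le_trans _ _ (lambda U0)).
    by apply: le_measure; rewrite ?inE //; exact: subIsetl.
  rewrite -{1}(setDUK NU0).
  apply: le_trans (measureU2 _ mN (measurableD mU0 mN)) _.
  by rewrite [X in (X + _)%E](_ : _ = 0%E) ?add0e.
pose I := open_disjoint_itv oU.
have IU n : I n `<=` U.
  by rewrite (open_disjoint_itv_bigcup oU); exact: bigcup_sup.
have mI n : measurable (I n : set (measurableTypeR R)).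
  by apply: open_measurable; exact: open_disjoint_itv_open.
have tI : trivIset setT I by exact: open_disjoint_itv_trivIset.
have Ie n := open_interval_itvoo (@open_disjoint_itv_open _ _ oU n)
  (@open_disjoint_itv_is_interval _ _ oU n)
  (subset_trans (IU n) (@subIsetr _ _ _)).
pose ab (n : nat) := (inf (I n), sup (I n)).
have ab_le n : (ab n).1 <= (ab n).2 by have [] := Ie n.
have Iab n : I n = `](ab n).1, (ab n).2[%classic by have [] := Ie n.
have lI n : lambda (I n) = ((ab n).2 - (ab n).1)%:E.
  rewrite [in LHS]Iab lebesgue_measure_itv /= lte_fin EFinB.
  by case: ltgtP (ab_le n) => // -> _; rewrite subee.
have lab k : \sum_(i <- iota 0 k) ((ab i).2 - (ab i).1) < d.
  rewrite -lte_fin -sumEFin; apply: le_lt_trans lU.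
  under eq_bigr do rewrite -lI.
  rewrite -[k in iota _ k]subn0 -/(index_iota 0 k) big_mkord -measure_bigsetU //.
  apply: le_measure; rewrite ?inE //; first exact: bigsetU_measurable.
  by rewrite -bigcup_mkord => x [i _]; exact: IU.
have famk k : itv_family [seq ab i | i <- iota 0 k].
  rewrite /itv_family; apply/andP; split.
    by apply/allP => _ /mapP[i _ ->].
  rewrite pairwise_map.
  have := iota_ltn_sorted 0 k; rewrite (sorted_pairwise ltn_trans).
  apply: sub_pairwise => i j /= ij.
  have [_ i1 i2 i3] := Ie i; have [_ j1 j2 j3] := Ie j.
  apply: itvoo_nonoverlap => //.
  rewrite -[X in X `&` _]Iab -[X in _ `&` X]Iab.
  move/trivIsetP : tI; apply => //.
  by rewrite ltn_eqF.
apply: (@le_trans _ _ (lebesgue_stieltjes_measure phi U)).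
  by apply: le_measure; rewrite ?inE.
have UI : U = \bigcup_n I n by exact: open_disjoint_itv_bigcup.
rewrite UI measure_semi_bigcup //; last by rewrite -UI.
apply: lime_le; first exact: is_cvg_nneseries.
apply: nearW => k.
have := H _ (famk k); rewrite !big_map => /(_ (lab k)); rewrite -lee_fin.
apply: le_trans; rewrite -sumEFin /index_iota subn0; apply: lee_sum => i _.
apply: le_trans (_ : _ <= (phi (ab i).2 - phi (ab i).1)%:E)%E _; last first.
  by rewrite lee_fin ler_norm.
by rewrite [I i]Iab; exact: stieltjes_oo.
Qed.
End ac_density.

(** * Densities and the fundamental theorem of calculus *)

Section ac_ftc.
Context {R : realType}.
Implicit Types (a b x y d e : R) (f g h : R -> R) (s : seq (R * R)).
Notation lambda := (@lebesgue_measure R).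

Lemma nondecreasing_acfun_density f : acfun f -> nondecreasing f ->
  exists h, lambda.-integrable setT (EFin \o h) /\
    forall x, 0 <= x <= 1 ->
      (f x - f 0)%:E = (\int[lambda]_(t in `[0%R, x]) (h t)%:E)%E.
Proof.
move=> acf ndf.
have rcf : right_continuous f.
  by move=> x; apply: cvg_at_right_filter; exact: acfun_continuous.
pose C := isCumulative.Build _ _ _ f ndf rcf.
pose phi : cumulative R R := HB.pack f C.
(* Restricting to []0, 1]] makes the Stieltjes measure finite and leaves no mass at 0, so [[0, x]]
   receives exactly [f x - f 0]. *)
pose D : set (measurableTypeR R) := `]0%R, 1%R]%classic.
have mD : measurable D by exact: measurable_itv.
pose m := lebesgue_stieltjes_measure phi.
have mDy : (m D < +oo)%E by rewrite /m /D stieltjes_oc ?ltry.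
pose nu : {finite_measure set (measurableTypeR R) -> \bar R} := mfrestr mD mDy.
have nulambda : nu `<< lambda.
  apply/null_content_dominatesP => A mA A0.
  apply/eqP; rewrite eq_le measure_ge0 andbT.
  apply/lee_addgt0Pr => e e0; rewrite add0e.
  have [d d0 H] := acf _ e0.
  apply: (@stieltjes_dominated _ phi e d _ H d0).
  - exact: measurableI.
  - exact: subIsetr.
  - apply/eqP; rewrite eq_le measure_ge0 andbT -A0.
    by apply: le_measure; rewrite ?inE //; exact: measurableI.
have [h [h0 hfin hint hE]] := radon_nikodym_sigma_finite nulambda.
exists (fine \o h); split.
  apply: eq_integrable hint => // t _ /=.
  by rewrite fineK.
move=> x /andP[x0 x1].
transitivity (nu `[0%R, x]%classic); last first.
  rewrite hE; last exact: measurable_itv.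
  by apply: eq_integral => t _; rewrite fineK.
rewrite /nu /= /mfrestr /mrestr.
have -> : `[0, x]%classic `&` D = `]0, x]%classic.
  apply/seteqP; split => t; rewrite /D /= !in_itv /=.
    by move=> [/andP[_ ->] /andP[->]].
  by move=> /andP[t0 tx]; rewrite tx (ltW t0) t0 (le_trans tx x1).
by rewrite stieltjes_oc.
Qed.

Lemma acfun_ftc f : acfun f -> exists h,
  [/\ lambda.-integrable setT (EFin \o h),
      (f 1 - f 0)%:E = (\int[lambda]_(t in `[0%R, 1%R]) (h t)%:E)%E &
      {ae lambda, forall x, 0 < x < 1 -> derivable f x 1 /\ f^`()%classic x = h x}].
Proof.
move=> /acfun_decomposition[phi [psi [aphi apsi ndphi ndpsi fE]]].
have [h1 [ih1 h1E]] := nondecreasing_acfun_density aphi ndphi.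
have [h2 [ih2 h2E]] := nondecreasing_acfun_density apsi ndpsi.
have ih : lambda.-integrable setT (EFin \o (h1 \- h2)).
  by apply: eq_integrable (integrableB _ ih1 ih2) => // x _; rewrite /= EFinB.
have fh x : 0 <= x <= 1 ->
    (f x - f 0)%:E = (\int[lambda]_(t in `[0%R, x]) ((h1 \- h2) t)%:E)%E.
  move=> /[dup] x01 /andP[x0 _]; rewrite /=.
  under eq_integral do rewrite EFinB.
  have S i : lambda.-integrable setT i -> lambda.-integrable `[0%R, x] i.
    by apply: integrableS => //; exact: measurable_itv.
  rewrite integralB_EFin //; [|exact: S|exact: S].
  rewrite -h1E // -h2E // -EFinB !fE //; congr EFin; ring.
exists (h1 \- h2); split => //; first by apply: fh; rewrite lexx ler01.
have loc : locally_integrable setT (h1 \- h2).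
  by apply: open_integrable_locally => //; exact: openT.
have intS y : lambda.-integrable [set` Interval (BLeft 0) (BRight y)]
    (EFin \o (h1 \- h2)).
  by apply: integrableS ih => //; exact: measurable_itv.
have := FTC1 intS loc; apply: filterS; first exact: (ae_filter_ringOfSetsType lambda).
move=> x H /andP[x0 x1].
have [] := H _; first by rewrite lte_fin.
set G := fun y : R => _ => dG GE.
(* The integral formula holds only on [[0, 1]], hence near an interior point, which is enough to
   transfer the derivative. *)
have Gf : {near x, G + cst (f 0) =1 f}.
  near=> y.
  have y01 : 0 <= y <= 1.
    by apply/andP; split; apply: ltW; near: y; [exact: lt_nbhsr|exact: lt_nbhsl].
  have -> : (G + cst (f 0)) y = G y + f 0 by [].
  by rewrite /G /Rintegral -fh //= subrK.
have dG' : derivable (G + cst (f 0)) x 1 by exact: (derivableD dG (derivable_cst _ _ _)).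
split; first exact: near_eq_derivable Gf dG'.
by rewrite derive1E -(near_eq_derive _ Gf) deriveD // derive_cst addr0 -derive1E.
Unshelve. all: by end_near. Qed.
End ac_ftc.

(** * Integrands with non-measurable velocity *)

Section ae_integral.
Import HBNNSimple.
Local Open Scope ereal_scope.
Context d (T : measurableType d) (R : realType).
Variables (mu : {measure set T -> \bar R}).
Implicit Types (f h : T -> \bar R) (D : set T).

(** The integral of a nonnegative function is a supremum over the simple functions below it, and
    each competitor on [E] is one on [D]. *)
Lemma le_integral_subset D (E : set T) f : E `<=` D -> (forall x, D x -> 0 <= f x) ->
  \int[mu]_(x in E) f x <= \int[mu]_(x in D) f x.
Proof.
move=> ED f0; rewrite !ge0_integralE //; last by move=> x /ED; exact: f0.
apply: ereal_sup_le => _ [s /= sf <-].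
exists s => //= x; apply: le_trans (sf x) _; rewrite !patchE.
case: ifPn => [|_]; first by rewrite inE => /ED Dx; rewrite mem_set.
by case: ifPn => //; rewrite inE => /f0.
Qed.

(* Unlike in [ge0_ae_eq_integral], [f] may be non-measurable, as [F \o vel g]
   might be. *)
Lemma ge0_ae_eq_integralW D f h : measurable D -> measurable_fun D h ->
  (forall x, D x -> 0 <= f x) -> (forall x, D x -> 0 <= h x) ->
  {ae mu, forall x, D x -> f x = h x} ->
  \int[mu]_(x in D) f x = \int[mu]_(x in D) h x.
Proof.
move=> mD mh f0 h0 [A [mA A0 NA]].
have fh x : (D `\` A) x -> f x = h x.
  by move=> [Dx nAx]; apply: contrapT => nfh; apply: nAx; apply: NA => /(_ Dx).
have mDA : measurable (D `\` A) by exact: measurableD.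
have mhDA : measurable_fun (D `\` A) h by apply: measurable_funS mh => //; exact: subDsetl.
apply/eqP; rewrite eq_le; apply/andP; split; last first.
  rewrite (ge0_negligible_integral mA) //.
  rewrite -(@eq_integral _ _ _ mu (D `\` A) h f); last first.
    by move=> x /set_mem; exact: fh.
  by apply: le_integral_subset => //; exact: subDsetl.
(* For the upper bound, each simple function below [f] is itself measurable, so its integral can be
   computed off the null set [A], where it lies below [h]. *)
rewrite ge0_integralE //; apply: ge_ereal_sup => _ [s /= sf <-].
apply: (@le_trans _ _ (\int[mu]_(x in D `\` A) h x)); last first.
  by apply: le_integral_subset => //; exact: subDsetl.
have s0 x : 0 <= (s x)%:E by rewrite lee_fin.
have ms : measurable_fun setT (EFin \o s) by exact/measurable_EFinP.
have -> : sintegral mu s = \int[mu]_x (s x)%:E.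
  by rewrite integral_nnsfun // patch_setT.
rewrite (ge0_negligible_integral mA) //.
rewrite [leRHS]integral_mkcond.
have h0' x : 0 <= (h \_ (D `\` A)) x.
  by rewrite patchE; case: ifPn => //; rewrite inE => -[/h0].
apply: (@le_trans _ _ (\int[mu]_(x in setT `\` A) (h \_ (D `\` A)) x)); last first.
  by apply: le_integral_subset.
apply: ge0_le_integral => //.
- exact: measurableD.
- by apply: measurable_funS ms => //.
- apply: (@measurable_funS _ _ _ _ setT) => //.
  exact/(measurable_restrictT _ _).1.
- move=> x [_ nAx]; apply: le_trans (sf x) _; rewrite !patchE.
  have [|nD] := boolP (x \in D); last first.
    by case: ifPn => //; rewrite inE => -[/h0].
  by rewrite inE => Dx; rewrite mem_set ?fh.
Qed.
End ae_integral.

(** * Measurability of lower semicontinuous functions of vector maps *)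

Section measurable_vector.
Context {R : realType} {n : nat} {d} {T : measurableType d}.
Implicit Types (H : T -> 'rV[R]_n).

(** An open set is the countable union of the cubes with rational centre and radius [1 / (k + 1)]
    inside it, and the preimage of a cube is a finite intersection of coordinate preimages. *)
Lemma measurable_preimage_open_rV H (U : set 'rV[R]_n) :
  (forall i, measurable_fun setT (fun t => H t ord0 i)) -> open U ->
  measurable (H @^-1` U).
Proof.
move=> mH oU.
pose B (p : 'rV[rat]_n * nat) : set 'rV[R]_n :=
  [set x | forall i, `|ratr (p.1 ord0 i) - x ord0 i| < p.2.+1%:R^-1].
pose F p : set T := [set t | B p `<=` U /\ B p (H t)].
have -> : H @^-1` U = \bigcup_p F p.
  apply/seteqP; split=> [t Ut|t [p _ [BU /BU]]//].
  have /nbhs_ballP[e /= e0 eU] : nbhs (H t) U by exact: open_nbhs_nbhs.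
  have [k ke] : exists k : nat, k.+1%:R^-1 < e / 2.
    have e20 : 0 < e / 2 by rewrite divr_gt0.
    exists (Num.bound (e / 2)^-1).
    rewrite invf_plt ?posrE //; apply: lt_le_trans (archi_boundP _) _.
      by rewrite invr_ge0 ltW.
    by rewrite ler_nat.
  have k0 : 0 < k.+1%:R^-1 :> R by rewrite invr_gt0.
  have /choice[q qH] i : exists q : rat, `|ratr q - H t ord0 i| < k.+1%:R^-1.
    have /rat_in_itvoo[q] : H t ord0 i < H t ord0 i + k.+1%:R^-1 by rewrite ltrDl.
    rewrite in_itv /= => /andP[q1 q2]; exists q.
    by rewrite gtr0_norm ?subr_gt0 // ltrBlDl.
  exists (\row_i q i, k) => //; split; last by move=> i; rewrite mxE.
  move=> x Bx; apply: eU; split => // i j; rewrite (ord1 i) /ball /=.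
  rewrite (splitr e) -[_ - _](subrKA (ratr (q j))).
  apply: le_lt_trans (ler_normD _ _) _.
  apply: ltrD; apply: lt_trans ke; first by rewrite distrC.
  by have := Bx j; rewrite mxE.
apply: countable_bigcupT_measurable => // p.
have [BU|nBU] := pselect (B p `<=` U); last first.
  rewrite (_ : F p = set0) //; apply/seteqP; split => // t [].
  by [].
have -> : F p = \bigcap_(i in [set: 'I_n])
    ((fun t => H t ord0 i) @^-1` ball (ratr (p.1 ord0 i) : R) p.2.+1%:R^-1).
  by apply/seteqP; split => [t [_ Bt] i _|t Bt]; [exact: Bt|split => // i; exact: Bt].
apply: fin_bigcap_measurable => // i _.
rewrite -[_ @^-1` _]setTI; apply: mH => //; exact: measurable_ball.
Qed.

(** Strict superlevel sets of a lower semicontinuous function are open, and they generate the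
    measurability test. *)
Lemma measurable_lsc_comp (F : 'rV[R]_n -> R) H :
  lower_semicontinuous (fun x => (F x)%:E) ->
  (forall i, measurable_fun setT (fun t => H t ord0 i)) ->
  measurable_fun setT (fun t => (F (H t))%:E).
Proof.
move=> /lower_semicontinuousP lF mH.
apply: (measurability _ (ErealGenOInfty.measurableE R)).
move=> /= _ [_ [a ->]] <-; apply: measurableI => //.
rewrite preimage_itvoy.
exact: (measurable_preimage_open_rV mH (lF a)).
Qed.
End measurable_vector.

(** * Absolutely continuous curves *)

Section vector_ftc.
Context {R : realType} {n : nat}.
Implicit Types (g H : R -> 'rV[R]_n) (x y z : 'rV[R]_n) (s : seq (R * R)).
Notation lambda := (@lebesgue_measure R).

Lemma dotpC x y : dotp x y = dotp y x.
Proof. by apply: eq_bigr => i _; rewrite mulrC. Qed.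

Lemma dotp_ge0 x : 0 <= dotp x x.
Proof. by apply: sumr_ge0 => i _; rewrite -expr2 sqr_ge0. Qed.

Lemma coord_le_enorm x i : `|x ord0 i| <= enorm x.
Proof.
rewrite -sqrtr_sqr ler_sqrt ?dotp_ge0 // /dotp (bigD1 i) //= -expr2 lerDl.
by apply: sumr_ge0 => j _; rewrite -expr2 sqr_ge0.
Qed.

(** Serves twice: to extend curves constantly beyond [[0, 1]], and as the clock of a leg of a
    polygonal curve. *)
Definition clamp01 (t : R) := Num.max 0 (Num.min t 1).

Lemma clamp01_homo : {homo clamp01 : t u / t <= u}.
Proof.
move=> t u tu; rewrite /clamp01 ge_max !le_max lexx /= le_min !ge_min tu lexx.
by rewrite !orbT.
Qed.

Lemma clamp01_itv t : 0 <= clamp01 t <= 1.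
Proof. by rewrite /clamp01 le_max lexx ge_max ler01 ge_min lexx orbT. Qed.

Lemma clamp01_id t : 0 <= t <= 1 -> clamp01 t = t.
Proof. by move=> /andP[t0 t1]; rewrite /clamp01 (min_idPl t1) (max_idPr t0). Qed.

Lemma clamp01_lip t u : t <= u -> clamp01 u - clamp01 t <= u - t.
Proof.
by move=> tu; rewrite /clamp01; case: (leP t 1) => h1; case: (leP u 1) => h2;
  case: (leP 0 t) => h3; case: (leP 0 u) => h4; case: (leP (0 : R) 1) => h5; lra.
Qed.

(** [acfun] tests families on the whole line; clamping keeps them nonoverlapping, does not lengthen
    them and moves them into [[0, 1]], where [AC01] applies. *)
Lemma AC01_acfun g i : AC01 g -> acfun (fun t => g (clamp01 t) ord0 i).
Proof.
move=> acg e e0; have [d d0 H] := acg _ e0; exists d => // s fs sd.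
pose p k := (clamp01 (nth (0, 0) s k).1, clamp01 (nth (0, 0) s k).2).
pose a (k : 'I_(size s)) := (p k).1; pose b (k : 'I_(size s)) := (p k).2.
have /andP[/allP s1 /(pairwiseP (0, 0)) s2] := itv_family_map clamp01_homo fs.
have E k : (k < size s)%N -> p k = nth (0, 0) [seq (clamp01 p.1, clamp01 p.2) | p <- s] k.
  by move=> ks; rewrite (nth_map (0, 0)).
have nov (j k : 'I_(size s)) : (j < k)%N -> nonoverlap (p j) (p k).
  by move=> jk; rewrite !E //; apply: s2 => //; rewrite inE size_map.
have h1 k : 0 <= a k /\ a k <= b k /\ b k <= 1.
  have /andP[? _] := clamp01_itv (nth (0, 0) s k).1.
  have /andP[_ ?] := clamp01_itv (nth (0, 0) s k).2.
  split => //; split => //; apply: clamp01_homo.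
  by case/andP: fs => /allP + _; apply; exact: mem_nth.
have h2 j k : j != k -> b j <= a k \/ b k <= a j.
  move=> jk; have : (j < k)%N || (k < j)%N by rewrite -neq_ltn.
  by case/orP => /nov /orP[]; auto.
have h3 : \sum_(k < size s) (b k - a k) < d.
  apply: le_lt_trans sd; rewrite (big_nth (0, 0)) big_mkord; apply: ler_sum => k _.
  apply: clamp01_lip; by case/andP: fs => /allP + _; apply; exact: mem_nth.
apply: le_trans (ltW (H _ a b h1 h2 h3)).
rewrite (big_nth (0, 0)) big_mkord; apply: ler_sum => k _.
by apply: le_trans (coord_le_enorm _ i); rewrite !mxE.
Qed.

(** [H] is a representative of the velocity with integrable coordinates, assembled from the
    densities of the coordinate functions. *)
Lemma AC01_ftc g : AC01 g -> exists H : R -> 'rV[R]_n,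
  [/\ forall i, lambda.-integrable setT (EFin \o (fun t => H t ord0 i)),
      forall i, ((g 1 - g 0) ord0 i)%:E =
        (\int[lambda]_(t in `[0%R, 1%R]) (H t ord0 i)%:E)%E &
      {ae lambda, forall t, 0 < t < 1 -> vel g t = H t}].
Proof.
move=> acg.
have /choice[h hH] i := acfun_ftc (AC01_acfun i acg).
exists (fun t => \row_i h i t).
have he i : (fun t => (\row_i h i t) ord0 i) = h i by apply/funext => t; rewrite mxE.
split.
- by move=> i; rewrite he; have [] := hH i.
- move=> i; under eq_integral do rewrite mxE.
  have [_ <- _] := hH i.
  by rewrite !clamp01_id ?lexx ?ler01 // !mxE.
- have : {ae lambda, forall t, forall i, 0 < t < 1 ->
      derivable (fun t => g (clamp01 t) ord0 i) t 1 /\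
      (fun t => g (clamp01 t) ord0 i)^`()%classic t = h i t}.
    apply: (@filter_forall _ _ _ (almost_everywhere lambda) (ae_filter_ringOfSetsType lambda)).
    by move=> i; have [] := hH i.
  apply: filterS; first exact: (ae_filter_ringOfSetsType lambda).
  move=> t hd t01.
  have near_id i : {near t, (fun t => g (clamp01 t) ord0 i) =1 (fun t => g t ord0 i)}.
    have /andP[t0 t1] := t01.
    near=> u; rewrite clamp01_id //.
    by apply/andP; split; apply: ltW; near: u; [exact: lt_nbhsr|exact: lt_nbhsl].
  have dg : derivable g t 1.
    apply/derivable_mxP => j i; rewrite (ord1 j).
    by have [hd1 _] := hd i t01; exact: near_eq_derivable (near_id i) hd1.
  rewrite /vel derive1E derive_mx //; apply/rowP => i; rewrite !mxE.
  by rewrite -(near_eq_derive _ (near_id i)) -derive1E; have [] := hd i t01.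
Unshelve. all: by end_near. Qed.

Lemma AC01_integral_dotp g H x :
  (forall i, lambda.-integrable setT (EFin \o (fun t => H t ord0 i))) ->
  (forall i, ((g 1 - g 0) ord0 i)%:E =
        (\int[lambda]_(t in `[0%R, 1%R]) (H t ord0 i)%:E)%E) ->
  lambda.-integrable `[0%R, 1%R] (fun t => (dotp (H t) x)%:E) /\
  (\int[lambda]_(t in `[0%R, 1%R]) (dotp (H t) x)%:E = (dotp (g 1 - g 0) x)%:E)%E.
Proof.
move=> iH gH.
pose G i t := ((x ord0 i)%:E * (H t ord0 i)%:E)%E.
have dE t : (dotp (H t) x)%:E = (\sum_(i < n) G i t)%E.
  by rewrite /dotp -sumEFin; apply: eq_bigr => i _; rewrite /G -EFinM mulrC.
have iH' i : lambda.-integrable `[0%R, 1%R] (EFin \o (fun t => H t ord0 i)).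
  by apply: integrableS (iH i) => //; exact: measurable_itv.
have m01 : measurable (`[0%R, 1%R]%classic : set (measurableTypeR R)).
  exact: measurable_itv.
have iG i : lambda.-integrable `[0%R, 1%R] (G i).
  exact: (integrableZl m01 (x ord0 i) (iH' i)).
split.
  rewrite (_ : (fun t => _) = (fun t => \sum_(i < n) G i t)%E); last exact/funext.
  by apply: integrable_sum.
under eq_integral do rewrite dE.
rewrite integral_sum // /dotp -sumEFin; apply: eq_bigr => i _.
by rewrite (integralZl m01 (iH' i)) -gH -EFinM mulrC.
Qed.
End vector_ftc.

(** * Sublinear functions *)

Section sublinear.
Context {R : realType} {n : nat}.
Notation vec := 'rV[R]_n.
Implicit Types (p q : vec -> R) (x y z e v w : vec).

Definition sublinear p :=
  (forall v w, p (v + w) <= p v + p w) /\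
  (forall (l : R) v, 0 <= l -> p (l *: v) = l * p v).

Lemma sublinear0 p : sublinear p -> p 0 = 0.
Proof. by move=> [_ hp]; rewrite -[0](scale0r 0) hp ?mul0r. Qed.

Lemma sublinear_oppr p v : sublinear p -> - p (- v) <= p v.
Proof.
move=> sp; have := sp.1 v (- v); rewrite subrr sublinear0 //; lra.
Qed.

(* [straighten p e] is sublinear, below [p], and linear along [e]; iterating over
   a basis turns [p] into a linear functional. *)
Definition straighten p e v := inf [set p (v + t *: e) - t * p e | t in [set t : R | 0 <= t]].

Lemma straighten_lb p e v : sublinear p ->
  lbound [set p (v + t *: e) - t * p e | t in [set t : R | 0 <= t]] (- p (- v)).
Proof.
move=> sp _ [t /= t0 <-]; rewrite -sp.2 //.
by have := sp.1 (v + t *: e) (- v); rewrite addrC addKr; lra.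
Qed.

Lemma straighten_le p e v (t : R) : sublinear p -> 0 <= t ->
  straighten p e v <= p (v + t *: e) - t * p e.
Proof.
move=> sp t0; apply: ge_inf; last by exists t.
by exists (- p (- v)); exact: straighten_lb.
Qed.

Lemma le_straighten p e v (c : R) :
  (forall t, 0 <= t -> c <= p (v + t *: e) - t * p e) -> c <= straighten p e v.
Proof.
move=> H; apply: lb_le_inf; first by exists (p (v + 0 *: e) - 0 * p e); exists 0 => /=.
by move=> _ [t /= t0 <-]; exact: H.
Qed.

Lemma straighten_le_id p e v : sublinear p -> straighten p e v <= p v.
Proof.
by move=> sp; have := straighten_le e v sp (lexx 0); rewrite scale0r addr0 mul0r subr0.
Qed.

Lemma straighten_sublinear p e : sublinear p -> sublinear (straighten p e).
Proof.
move=> sp; split => [v w|l v].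
  rewrite -lerBlDr; apply: le_straighten => t t0.
  rewrite lerBlDr -lerBlDl; apply: le_straighten => u u0.
  rewrite lerBlDl; apply: le_trans (straighten_le e _ sp (addr_ge0 t0 u0)) _.
  have := sp.1 (v + t *: e) (w + u *: e).
  rewrite addrACA -scalerDl mulrDl; lra.
rewrite le_eqVlt => /orP[/eqP <-|l0].
  rewrite scale0r mul0r; apply/eqP; rewrite eq_le; apply/andP; split.
    by apply: le_trans (straighten_le_id _ _ sp) _; rewrite sublinear0.
  by apply: le_straighten => t t0; rewrite add0r sp.2 // subrr.
(* Rescaling the parameter [t] by [m] gives one inequality; the reverse one is this applied to the
   inverse factor. *)
have half (m : R) w : 0 < m -> straighten p e (m *: w) <= m * straighten p e w.
  move=> m0; rewrite mulrC -ler_pdivrMr //; apply: le_straighten => t t0.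
  rewrite ler_pdivrMr //.
  apply: le_trans (straighten_le e _ sp (mulr_ge0 (ltW m0) t0)) _.
  by rewrite -scalerA -scalerDr sp.2 ?(ltW m0) //; lra.
apply/eqP; rewrite eq_le half //=.
have li0 : 0 < l^-1 by rewrite invr_gt0.
have := half _ (l *: v) li0; rewrite scalerA mulVf ?gt_eqF // scale1r.
by rewrite mulrC ler_pdivlMr // mulrC.
Qed.

Lemma straightenN p e : sublinear p -> straighten p e (- e) <= - p e.
Proof.
move=> sp; have := straighten_le e (- e) sp ler01.
by rewrite scale1r addNr sublinear0 // mul1r sub0r.
Qed.

Definition linear_along p e := p (- e) = - p e.

(** Linearity along a line passes to smaller sublinear functions:
    [q e >= - q (- e) >= - p (- e) = p e]. *)
Lemma linear_along_le p q e : sublinear q -> (forall v, q v <= p v) ->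
  linear_along p e -> linear_along q e /\ q e = p e.
Proof.
move=> sq qp pe; have := qp e; have := qp (- e); have := sublinear_oppr e sq.
by rewrite /linear_along pe; split; lra.
Qed.

(** Straightening along a new vector [a] could lower the value at [e]. Straightening along [e] first
    keeps that value and makes it the same for every smaller sublinear function. *)
Lemma sublinear_minorant p (s : seq vec) e : sublinear p -> exists q,
  [/\ sublinear q, forall v, q v <= p v, q e = p e &
      {in s, forall v, linear_along q v}].
Proof.
move=> sp; elim: s => [|a s [q [sq qp qe qs]]].
  by exists p.
have [r [sr rq re ra rs]] : exists r, [/\ sublinear r, forall v, r v <= q v,
    r e = q e, linear_along r a & {in s, forall v, linear_along r v}].
  pose q1 := straighten q e.
  have sq1 : sublinear q1 by exact: straighten_sublinear.
  have q1q v : q1 v <= q v by exact: straighten_le_id.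
  have q1e : linear_along q1 e /\ q1 e = q e.
    have := straightenN e sq; have := q1q e; have := sublinear_oppr e sq1.
    by rewrite /linear_along -/q1; split; lra.
  pose q2 := straighten q1 a.
  have sq2 : sublinear q2 by exact: straighten_sublinear.
  have q21 v : q2 v <= q1 v by exact: straighten_le_id.
  exists q2; split => //.
  - by move=> v; exact: le_trans (q21 v) (q1q v).
  - by have [_ ->] := linear_along_le sq2 q21 q1e.1; exact: q1e.2.
  - have := straightenN a sq1; have := q21 a; have := sublinear_oppr a sq2.
    by rewrite /linear_along -/q2; lra.
  - move=> v /qs lv; have [lv1 _] := linear_along_le sq1 q1q lv.
    by have [] := linear_along_le sq2 q21 lv1.
exists r; split => //.
- by move=> v; exact: le_trans (rq v) (qp v).
- by rewrite re.
- by move=> v; rewrite inE => /orP[/eqP ->|/rs].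
Qed.

Lemma sublinear_sum p (I : Type) (s : seq I) (f : I -> vec) : sublinear p ->
  p (\sum_(i <- s) f i) <= \sum_(i <- s) p (f i).
Proof.
move=> sp; elim: s => [|a s ih]; first by rewrite !big_nil sublinear0.
by rewrite !big_cons; apply: le_trans (sp.1 _ _) _; rewrite lerD2l.
Qed.

(** Finite-dimensional Hahn-Banach: a sublinear minorant that is linear along every basis vector is
    linear, and its values on the basis are the coordinates of [x]. *)
Lemma sublinear_support p v0 : sublinear p -> exists x,
  (forall v, dotp v x <= p v) /\ p v0 = dotp v0 x.
Proof.
move=> sp; pose b i : vec := delta_mx ord0 i.
have [q [sq qp qv0 qb]] := sublinear_minorant [seq b i | i <- enum 'I_n] v0 sp.
have {}qb i : linear_along q (b i) by apply: qb; rewrite map_f // mem_enum.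
pose x : vec := \row_i q (b i).
have bE (v : vec) : v = \sum_i v ord0 i *: b i by exact: row_sum_delta.
have qZ (c : R) i : q (c *: b i) = c * q (b i).
  have [c0|/ltW c0] := leP 0 c; first by rewrite sq.2.
  have -> : c *: b i = (- c) *: (- b i) by rewrite scaleNr scalerN opprK.
  by rewrite sq.2 ?oppr_ge0 // qb mulrNN.
have q_le v : q v <= dotp v x.
  rewrite {1}[v]bE; apply: le_trans (sublinear_sum _ _ sq) _.
  by rewrite le_eqVlt; apply/orP; left; apply/eqP/eq_bigr => i _; rewrite qZ mxE.
(* The upper bound at [- v] is the lower bound at [v]. *)
have le_q v : dotp v x <= q v.
  have := q_le (- v); have := sublinear_oppr v sq.
  suff -> : dotp (- v) x = - dotp v x by lra.
  by rewrite /dotp -sumrN; apply: eq_bigr => i _; rewrite !mxE mulNr.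
exists x; split => [v|]; first exact: le_trans (le_q v) (qp v).
by apply/eqP; rewrite -qv0 eq_le q_le le_q.
Qed.

End sublinear.

(** * The crystal and the convex envelope *)

Section euclidean.
Context {R : realType} {n : nat}.
Implicit Types (x y z v w : 'rV[R]_n).

Lemma dotpDl x y z : dotp (x + y) z = dotp x z + dotp y z.
Proof. by rewrite /dotp -big_split; apply: eq_bigr => i _; rewrite mxE mulrDl. Qed.

Lemma dotpZl (a : R) x z : dotp (a *: x) z = a * dotp x z.
Proof. by rewrite /dotp mulr_sumr; apply: eq_bigr => i _; rewrite mxE mulrA. Qed.

Lemma dotpZr (a : R) x z : dotp x (a *: z) = a * dotp x z.
Proof. by rewrite dotpC dotpZl dotpC. Qed.

Lemma dotpBl x y z : dotp (x - y) z = dotp x z - dotp y z.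
Proof. by rewrite dotpDl -scaleN1r dotpZl mulN1r. Qed.

Lemma dotp0l x : dotp 0 x = 0.
Proof. by rewrite -(scale0r 0) dotpZl mul0r. Qed.

Lemma enorm_ge0 x : 0 <= enorm x. Proof. exact: sqrtr_ge0. Qed.

Lemma enormZ (a : R) x : enorm (a *: x) = `|a| * enorm x.
Proof.
by rewrite /enorm dotpZl dotpZr mulrA -expr2 sqrtrM ?sqr_ge0 // sqrtr_sqr.
Qed.

Lemma enorm_eq0 x : (enorm x == 0) = (x == 0).
Proof.
apply/eqP/eqP => [x0|->]; last by rewrite /enorm dotp0l sqrtr0.
apply/rowP => i; rewrite mxE; apply/eqP; rewrite -normr_le0 -x0.
exact: coord_le_enorm.
Qed.

Lemma enorm_gt0 x : x != 0 -> 0 < enorm x.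
Proof. by move=> x0; rewrite lt_neqAle enorm_ge0 andbT eq_sym enorm_eq0. Qed.

Lemma dotp_enorm x : dotp x x = enorm x ^+ 2.
Proof. by rewrite /enorm sqr_sqrtr ?dotp_ge0. Qed.

Lemma sphere_normalize x : x != 0 -> sphere ((enorm x)^-1 *: x).
Proof.
move=> x0; rewrite /sphere /= enormZ ger0_norm ?invr_ge0 ?enorm_ge0 //.
by rewrite mulVf // enorm_eq0.
Qed.

Lemma normalizeK x : enorm x *: ((enorm x)^-1 *: x) = x.
Proof.
have [->|x0] := eqVneq x 0; first by rewrite !scaler0.
by rewrite scalerA mulfV ?scale1r // enorm_eq0.
Qed.

Lemma sphere_neq0 x : sphere x -> x != 0.
Proof. by move=> sx; rewrite -enorm_eq0 (sx : enorm x = 1) oner_eq0. Qed.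

End euclidean.

(** * Support function, gauge and polygonal convexification of the crystal *)

Section crystal.
Context {R : realType} {n : nat}.
Variable F : 'rV[R]_n -> R.
Hypotheses (Fhom : homogeneous1 F) (Fpos : positive_on_sphere F).
Implicit Types (x y z v w : 'rV[R]_n).

Lemma hom0 : F 0 = 0.
Proof. by rewrite -(scale0r 0) Fhom ?mul0r. Qed.

Lemma hom_ge0 v : 0 <= F v.
Proof.
have [->|v0] := eqVneq v 0; first by rewrite hom0.
rewrite -[v]normalizeK Fhom ?enorm_ge0 // mulr_ge0 ?enorm_ge0 // ltW //.
exact/Fpos/sphere_normalize.
Qed.

Lemma crystalP x : crystal F x <-> forall v, dotp x v <= F v.
Proof.
split=> [Kx v|H v _]; last exact: H.
have [->|v0] := eqVneq v 0; first by rewrite dotpC dotp0l hom0.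
rewrite -[v]normalizeK Fhom ?enorm_ge0 // dotpZr ler_wpM2l ?enorm_ge0 //.
exact/Kx/sphere_normalize.
Qed.

Lemma crystal0 : crystal F 0.
Proof. by apply/crystalP => v; rewrite dotp0l hom_ge0. Qed.

(** The constraints in the directions of plus and minus the basis vectors confine the crystal to a
    box. This keeps the suprema finite and the gauge set nonempty. *)
Lemma crystal_dotp_bounded z : exists2 c, 0 <= c & forall x, crystal F x -> dotp z x <= c.
Proof.
pose b i : 'rV[R]_n := delta_mx ord0 i.
have bE x i : dotp x (b i) = x ord0 i.
  rewrite /dotp (bigD1 i) //= big1 ?addr0 => [|j ji].
    by rewrite mxE !eqxx mulr1.
  by rewrite mxE eqxx (negbTE ji) mulr0.
exists (\sum_i `|z ord0 i| * (F (b i) + F (- b i))).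
  by apply: sumr_ge0 => i _; rewrite mulr_ge0 // addr_ge0 // hom_ge0.
move=> x /crystalP Kx; apply: ler_sum => i _.
apply: le_trans (ler_norm _) _; rewrite normrM ler_wpM2l // ler_norml.
have h1 := Kx (b i); have h2 := Kx (- b i).
have := hom_ge0 (b i); have := hom_ge0 (- b i).
move: h1 h2; rewrite -scaleN1r dotpZr bE => h1 h2 h3 h4.
by apply/andP; split; lra.
Qed.

Lemma dotp_le_normF z x : crystal F x -> dotp z x <= normF F z.
Proof.
move=> Kx; apply: lb_le_inf.
  (* The bound [c] may be 0, so [z] is divided by [c + 1] to land in the polar body. *)
  have [c c0 cH] := crystal_dotp_bounded z; have c1 : 0 < c + 1 by lra.
  exists (c + 1) => /=; split; first exact: ltW.
  exists ((c + 1)^-1 *: z); last by rewrite scalerA mulfV ?scale1r // gt_eqF.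
  move=> y /cH yc; rewrite dotpZl mulrC ler_pdivrMr //; lra.
by move=> l /= [l0 [y /(_ _ Kx) yx ->]]; rewrite dotpZl ler_piMr.
Qed.

Lemma hom_extE f v : v != 0 -> hom_ext f v = enorm v * f ((enorm v)^-1 *: v).
Proof. by rewrite /hom_ext => /negbTE ->. Qed.

Let Wset w := [set F u / dotp w u | u in [set u | sphere u /\ 0 < dotp w u]].

Lemma Wop_sphere w : sphere w -> Wop F w = inf (Wset w).
Proof.
move=> sw; rewrite /Wop hom_extE; last exact: sphere_neq0.
by rewrite (sw : enorm w = 1) mul1r invr1 scale1r.
Qed.

Lemma le_Wop w (c : R) : sphere w ->
  (forall u, sphere u -> 0 < dotp w u -> c * dotp w u <= F u) -> c <= Wop F w.
Proof.
move=> sw H; rewrite Wop_sphere //; apply: lb_le_inf.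
  exists (F w / dotp w w); exists w => //; split => //.
  by rewrite dotp_enorm (sw : enorm w = 1) expr1n.
by move=> _ [u /= [su wu] <-]; rewrite ler_pdivlMr //; exact: H.
Qed.

Lemma Wop_ge0 w : sphere w -> 0 <= Wop F w.
Proof. by move=> sw; apply: le_Wop => // u su _; rewrite mul0r hom_ge0. Qed.

(* [Wop F] is the radial function of the crystal. *)
Lemma crystal_Wop w : sphere w -> crystal F (Wop F w *: w).
Proof.
move=> sw u su; rewrite dotpZl.
have [wu|wu] := ltP 0 (dotp w u); last first.
  by apply: le_trans (hom_ge0 u); rewrite mulr_ge0_le0 // Wop_ge0.
rewrite -ler_pdivlMr // Wop_sphere //; apply: ge_inf; last by exists u.
by exists 0 => _ [y /= [sy wy] <-]; rewrite divr_ge0 ?hom_ge0 // ltW.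
Qed.

Let Dset v := [set Wop F w * dotp ((enorm v)^-1 *: v) w | w in sphere].

Lemma DopE v : v != 0 -> Dop F v = enorm v * sup (Dset v).
Proof. exact: hom_extE. Qed.

(** Tests [c] at the crystal point [Wop F w *: w]. This yields both the upper estimate of [Dop] and
    the boundedness of its defining supremum. *)
Lemma Dset_le v w (c : R) : v != 0 -> sphere w -> (forall y, crystal F y -> dotp v y <= c) ->
  Wop F w * dotp ((enorm v)^-1 *: v) w <= c / enorm v.
Proof.
move=> v0 sw H; rewrite dotpZl ler_pdivlMr ?enorm_gt0 //.
have := H _ (crystal_Wop sw); rewrite dotpZr; apply: le_trans.
rewrite le_eqVlt; apply/orP; left; apply/eqP.
by field; rewrite enorm_eq0.
Qed.

Lemma Dop_le v (c : R) : (forall y, crystal F y -> dotp v y <= c) -> Dop F v <= c.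
Proof.
move=> H; have [->|v0] := eqVneq v 0.
  rewrite /Dop /Aop /hom_ext eqxx; have := H _ crystal0.
  by rewrite dotpC dotp0l.
rewrite DopE // mulrC -ler_pdivlMr ?enorm_gt0 //; apply: ge_sup.
  by exists (Wop F ((enorm v)^-1 *: v) * dotp ((enorm v)^-1 *: v) ((enorm v)^-1 *: v));
    exists ((enorm v)^-1 *: v) => //; exact: sphere_normalize.
by move=> _ [w sw <-]; exact: Dset_le.
Qed.

(** Write [y] as [enorm y] times a unit vector [w]; then [enorm y <= Wop F w]. If [dotp v w >= 0],
    the supremum defining [Dop] dominates; otherwise [Dop F v >= 0] suffices. *)
Lemma dotp_le_Dop v y : crystal F y -> dotp v y <= Dop F v.
Proof.
move=> Ky; have [->|v0] := eqVneq v 0.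
  by rewrite /Dop /Aop /hom_ext eqxx dotp0l.
have key w : sphere w -> Wop F w * dotp v w <= Dop F v.
  move=> sw; rewrite DopE // mulrC -ler_pdivrMl ?enorm_gt0 //.
  apply: ub_le_sup; last by exists w => //; rewrite dotpZl; ring.
  have [c c0 cH] := crystal_dotp_bounded v.
  by exists (c / enorm v) => _ [u su <-]; exact: Dset_le.
have D0 : 0 <= Dop F v.
  have sv := sphere_normalize v0.
  apply: le_trans (key _ sv); rewrite mulr_ge0 ?Wop_ge0 // dotpZr.
  by rewrite mulr_ge0 ?dotp_ge0 // invr_ge0 enorm_ge0.
have [->|y0] := eqVneq y 0; first by rewrite dotpC dotp0l.
have sy := sphere_normalize y0; set w := _ *: y in sy.
have yW : enorm y <= Wop F w.
  by apply: le_Wop => // u su _; rewrite -dotpZl normalizeK; exact: (crystalP y).1.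
rewrite -[y]normalizeK -/w dotpZr.
have [vw|vw] := leP 0 (dotp v w).
  by apply: le_trans (key _ sy); rewrite ler_wpM2r.
by apply: le_trans D0; rewrite mulr_ge0_le0 ?enorm_ge0 // ltW.
Qed.

Lemma Dop_le_id v : Dop F v <= F v.
Proof. by apply: Dop_le => y /crystalP /(_ v); rewrite dotpC. Qed.

(** Both hyperplanes are orthogonal to [u], so they agree iff their levels do, and the supporting
    level is [Dop F u / enorm u]. *)
Lemma is_supp_hyperplaneP xbar u : u != 0 -> crystal F xbar ->
  is_supp_hyperplane (crystal F) xbar u <-> (dotp u xbar = Dop F u).
Proof.
move=> u0 Kx; have nu := enorm_gt0 u0.
have supE : sup [set dotp y ((enorm u)^-1 *: u) | y in crystal F] = (enorm u)^-1 * Dop F u.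
  apply/eqP; rewrite eq_le; apply/andP; split.
    apply: ge_sup; first by exists (dotp xbar ((enorm u)^-1 *: u)); exists xbar.
    move=> _ [y Ky <-]; rewrite dotpZr ler_pM2l ?invr_gt0 // dotpC.
    exact: dotp_le_Dop.
  rewrite mulrC ler_pdivrMr //; apply: Dop_le => y Ky.
  rewrite -ler_pdivrMr //; apply: ub_le_sup; last first.
    by exists y => //; rewrite dotpZr mulrC dotpC.
  exists ((enorm u)^-1 * Dop F u) => _ [z Kz <-].
  by rewrite dotpZr ler_pM2l ?invr_gt0 // dotpC dotp_le_Dop.
have iu : (enorm u)^-1 != 0 by rewrite invr_eq0 gt_eqF.
split=> [[_ E]|E].
  have : [set z | dotp (z - xbar) u = 0] xbar by rewrite /= subrr dotp0l.
  rewrite E /supp_hyperplane /= supE dotpZr => /(mulfI iu).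
  by rewrite dotpC.
split=> //; apply/seteqP; split=> z /=; rewrite dotpBl /supp_hyperplane /= supE dotpZr -E.
  by move/eqP; rewrite subr_eq0 => /eqP ->; rewrite [dotp u _]dotpC.
by move/(mulfI iu) => ->; rewrite [dotp u _]dotpC subrr.
Qed.

(* The convexification of [F]: its value at [v] is the infimal total cost of
   polygonal paths from [0] to [v]. *)
Let G v := inf [set \sum_(u <- s) F u | s in [set s : seq 'rV[R]_n | \sum_(u <- s) u = v]].

Let Glb v : lbound [set \sum_(u <- s) F u |
  s in [set s : seq 'rV[R]_n | \sum_(u <- s) u = v]] 0.
Proof. by move=> _ [s _ <-]; apply: sumr_ge0 => u _; exact: hom_ge0. Qed.

Let G_le (s : seq 'rV[R]_n) : G (\sum_(u <- s) u) <= \sum_(u <- s) F u.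
Proof. by apply: ge_inf; [exists 0; exact: Glb|exists s]. Qed.

Let le_G v (c : R) :
  (forall s : seq 'rV[R]_n, \sum_(u <- s) u = v -> c <= \sum_(u <- s) F u) -> c <= G v.
Proof.
move=> H; apply: lb_le_inf; last by move=> _ [s /= sv <-]; exact: H.
by exists (\sum_(u <- [:: v]) F u); exists [:: v] => //=; rewrite big_seq1.
Qed.

(** Decompositions of [v] and [w] concatenate to one of [v + w], and scaling a decomposition scales
    its cost. *)
Let G_sublinear : sublinear G.
Proof.
split=> [v w|l v].
  rewrite -lerBlDr; apply: le_G => s sv; rewrite lerBlDr -lerBlDl.
  apply: le_G => t tw; rewrite lerBlDl -big_cat -sv -tw -big_cat; exact: G_le.
rewrite le_eqVlt => /orP[/eqP <-|l0].
  rewrite scale0r mul0r; apply/eqP; rewrite eq_le; apply/andP; split.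
    by have := G_le [::]; rewrite !big_nil.
  by apply: le_G => s _; apply: sumr_ge0 => u _; exact: hom_ge0.
have half (m : R) w : 0 < m -> G (m *: w) <= m * G w.
  move=> m0; rewrite mulrC -ler_pdivrMr //; apply: le_G => s sw.
  rewrite ler_pdivrMr // -sw scaler_sumr.
  have := G_le [seq m *: u | u <- s]; rewrite !big_map => /le_trans; apply.
  rewrite mulrC mulr_sumr; apply: ler_sum => u _.
  by rewrite Fhom // ltW.
apply/eqP; rewrite eq_le half //=.
have li0 : 0 < l^-1 by rewrite invr_gt0.
have := half _ (l *: v) li0; rewrite scalerA mulVf ?gt_eqF // scale1r.
by rewrite mulrC ler_pdivlMr // mulrC.
Qed.

Lemma polygon_normF v (e : R) : 0 < e -> exists2 s : seq 'rV[R]_n,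
  \sum_(u <- s) u = v & \sum_(u <- s) F u <= normF F v + e.
Proof.
move=> e0; have [x [xG Gx]] := sublinear_support v G_sublinear.
(* The one-term decomposition shows [G <= F], so a functional below [G] is a point of the
   crystal. *)
have Kx : crystal F x.
  apply/crystalP => w; rewrite dotpC; apply: le_trans (xG w) _.
  by have := G_le [:: w]; rewrite !big_seq1.
have : G v < normF F v + e.
  by rewrite Gx; apply: le_lt_trans (dotp_le_normF v Kx) _; rewrite ltrDl.
rewrite /G => /inf_lt[|_ [s sv <-] /ltW sF]; last by exists s.
by exists (\sum_(u <- [:: v]) F u); exists [:: v] => //=; rewrite big_seq1.
Qed.

End crystal.

(** * Polygonal curves *)

Section polygon.
Context {R : realType} {n : nat}.
Variables (k : nat) (u : 'I_k.+1 -> 'rV[R]_n) (p : 'rV[R]_n).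
Notation lambda := (@lebesgue_measure R).
Let K : R := k.+1%:R.

(* The [i]-th leg is run at constant speed during the time interval
   [[i / K, (i + 1) / K]]. *)
Definition polygon (t : R) : 'rV[R]_n :=
  p + \sum_(i < k.+1) clamp01 (K * t - i%:R) *: u i.

Let K0 : 0 < K. Proof. by rewrite ltr0n. Qed.

Lemma clamp01_le0 (t : R) : t <= 0 -> clamp01 t = 0.
Proof. by move=> t0; rewrite /clamp01; case: (leP t 1) => h; case: (leP 0 _) => h'; lra. Qed.

Lemma clamp01_ge1 (t : R) : 1 <= t -> clamp01 t = 1.
Proof. by move=> t1; rewrite /clamp01 (min_idPr t1) (max_idPr ler01). Qed.

Lemma polygon0 : polygon 0 = p.
Proof.
rewrite /polygon big1 ?addr0 // => i _.
by rewrite mulr0 sub0r clamp01_le0 ?oppr_le0 ?scale0r.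
Qed.

Lemma polygon1 : polygon 1 = p + \sum_(i < k.+1) u i.
Proof.
congr (_ + _); apply: eq_bigr => i _; rewrite clamp01_ge1 ?scale1r //.
by rewrite mulr1 -natrB ?(ltnW (ltn_ord i)) // ler1n subn_gt0.
Qed.

Lemma enorm_le_coord (x : 'rV[R]_n) (M : R) : 0 <= M ->
  (forall i, `|x ord0 i| <= M) -> enorm x <= Num.sqrt n%:R * M.
Proof.
move=> M0 xM; rewrite -[M]ger0_norm // -sqrtr_sqr -sqrtrM ?ler0n //.
apply: ler_wsqrtr; rewrite /dotp.
rewrite -[n in n%:R]card_ord -sumr_const mulr_suml; apply: ler_sum => i _.
by rewrite mul1r -expr2 -real_normK ?num_real // ler_sqr ?nnegrE.
Qed.

(** Every coordinate is Lipschitz with constant [M], hence the curve with constant [L]; dividing by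
    [L + 1] covers [L = 0]. *)
Lemma polygon_AC01 : AC01 polygon.
Proof.
pose M := K * \sum_(i < k.+1) \sum_j `|u i ord0 j|.
have M0 : 0 <= M.
  by apply: mulr_ge0; [exact: ltW|apply: sumr_ge0 => i _; exact: sumr_ge0].
pose L := Num.sqrt n%:R * M.
have L0 : 0 <= L by rewrite mulr_ge0 ?sqrtr_ge0.
have lip s t : s <= t -> enorm (polygon t - polygon s) <= L * (t - s).
  move=> st; rewrite /L -mulrA; apply: enorm_le_coord.
    by rewrite mulr_ge0 ?subr_ge0.
  move=> j; rewrite /polygon opprD addrACA subrr add0r -sumrB summxE.
  apply: le_trans (ler_norm_sum _ _ _) _.
  rewrite /M mulrAC mulr_sumr; apply: ler_sum => i _.
  rewrite -scalerBl mxE normrM; apply: ler_pM => //.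
    have h : K * s - i%:R <= K * t - i%:R by rewrite lerD2r ler_pM2l.
    rewrite ger0_norm ?subr_ge0; last exact: clamp01_homo.
    by apply: le_trans (clamp01_lip h) _; rewrite mulrBr; lra.
  by rewrite (bigD1 j) //= lerDl; exact: sumr_ge0.
move=> e e0; have L1 : 0 < L + 1 by lra.
exists (e / (L + 1)); first by rewrite divr_gt0.
move=> m a b ab _ abd; apply: (@le_lt_trans _ _ (L * \sum_(i < m) (b i - a i))).
  rewrite mulr_sumr; apply: ler_sum => i _; apply: lip.
  by have [_ []] := ab i.
have s0 : 0 <= \sum_(i < m) (b i - a i).
  by apply: sumr_ge0 => i _; rewrite subr_ge0; have [_ []] := ab i.
by move: abd; rewrite ltr_pdivlMr //; lra.
Qed.

Lemma clamp01_leg (t : R) (j i : 'I_k.+1) : i%:R < K * t < i.+1%:R ->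
  clamp01 (K * t - j%:R) = if j == i then K * t - i%:R else (j < i)%:R.
Proof.
move=> /andP[it ti]; have [->|] := eqVneq j i.
  rewrite -natr1 in ti; rewrite clamp01_id //; apply/andP; split; lra.
rewrite -(inj_eq val_inj) /= neq_ltn => /orP[ji|ij].
  rewrite ji clamp01_ge1 //.
  have : (j.+1%:R : R) <= i%:R by rewrite ler_nat.
  by rewrite -natr1; lra.
rewrite ltnNge (ltnW ij) /= clamp01_le0 //.
have : (i.+1%:R : R) <= j%:R by rewrite ler_nat.
by lra.
Qed.

Lemma vel_polygon (t : R) (i : 'I_k.+1) : i%:R < K * t < i.+1%:R ->
  vel polygon t = K *: u i.
Proof.
move=> tE; have /andP[it ti] := tE.
(* During the open time interval of leg [i] the other clocks stand still, so the curve is affine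
   there. *)
have nearE j : {near t,
    (fun s => (K * u i ord0 j) * s + (polygon t ord0 j - K * u i ord0 j * t)) =1
    (fun s => polygon s ord0 j)}.
  near=> s.
  have sE : i%:R < K * s < i.+1%:R.
    have s1 : K^-1 * i%:R < s by near: s; apply: lt_nbhsr; rewrite ltr_pdivrMl.
    have s2 : s < K^-1 * i.+1%:R by near: s; apply: lt_nbhsl; rewrite ltr_pdivlMl.
    by rewrite -ltr_pdivrMl // s1 -ltr_pdivlMl.
  suff : polygon s ord0 j - polygon t ord0 j = K * u i ord0 j * (s - t) by lra.
  rewrite /polygon !mxE !summxE opprD addrACA subrr add0r -sumrB (bigD1 i) //=.
  rewrite big1 ?addr0 => [|l li].
    by rewrite !mxE (clamp01_leg i sE) (clamp01_leg i tE) eqxx; ring.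
  by rewrite !mxE (clamp01_leg l sE) (clamp01_leg l tE) (negbTE li) subrr.
have affD (c b : R) : is_derive t 1 (fun s : R => c * s + b) c.
  have -> : (fun s : R => c * s + b) = c *: id + cst b by [].
  by apply: is_derive_eq; rewrite addr0 scaler1.
have dg : derivable polygon t 1.
  apply/derivable_mxP => j l; rewrite (ord1 j); apply: near_eq_derivable (nearE l) _.
  by have [] := affD (K * u i ord0 l) (polygon t ord0 l - K * u i ord0 l * t).
rewrite /vel derive1E derive_mx //; apply/rowP => l; rewrite !mxE.
rewrite -(near_eq_derive _ (nearE l)).
by have [_ ->] := affD (K * u i ord0 l) (polygon t ord0 l - K * u i ord0 l * t).
Unshelve. all: by end_near. Qed.

Variable F : 'rV[R]_n -> R.
Hypotheses (Fhom : homogeneous1 F) (Fpos : positive_on_sphere F).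

(** On leg [i] the integrand is [K * F (u i)] by homogeneity, and the factor [K] cancels against the
    duration [1 / K]. *)
Lemma lengthF_polygon : (lengthF F polygon <= (\sum_(i < k.+1) F (u i))%:E)%E.
Proof.
pose leg (i : 'I_k.+1) : set R := `]i%:R / K, i.+1%:R / K[%classic.
pose h (i : 'I_k.+1) (t : R) : \bar R := (K * F (u i) * \1_(leg i) t)%:E.
have legP i t : leg i t = (i%:R < K * t < i.+1%:R) :> Prop.
  by rewrite /leg /= in_itv /= ltr_pdivrMr // ltr_pdivlMr // mulrC.
have mleg i : measurable (leg i : set (measurableTypeR R)) by exact: measurable_itv.
have mh i (D : set (measurableTypeR R)) : measurable_fun D (h i).
  apply/measurable_EFinP; apply: measurable_funM; first exact: measurable_cst.
  exact: measurable_indic.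
have I01E : I01 = `[0, 1]%classic :> set R.
  by apply/seteqP; split => t; rewrite /I01 /= in_itv.
have m01 : measurable (I01 : set (measurableTypeR R)).
  by rewrite I01E; exact: measurable_itv.
have KF i : 0 <= K * F (u i) by rewrite mulr_ge0 ?(ltW K0) ?hom_ge0.
have h0 i t : (0 <= h i t)%E by rewrite /h lee_fin mulr_ge0.
have -> : lengthF F polygon = (\int[lambda]_(t in I01) (\sum_(i < k.+1) h i t))%E.
  apply: ge0_ae_eq_integralW => //.
  - by apply: emeasurable_sum => i.
  - by move=> t _; rewrite lee_fin hom_ge0.
  - by move=> t _; apply: sume_ge0 => i _.
  (* The exceptional times are the breakpoints; all multiples of [1 / K] form a countable, hence
     null, set. *)
  pose N : set (measurableTypeR R) := range (fun i : nat => i%:R / K : R).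
  have cN : countable (N : set R) by exact: sub_countable (card_image_le _ _) _.
  exists N; split.
  + exact: countable_measurable.
  + exact: countable_lebesgue_measure0.
  move=> t /= nt; apply: contrapT => nN; apply: nt => /andP[t0 t1].
  have Kt0 : 0 <= K * t by rewrite mulr_ge0 // ltW.
  pose j := Num.trunc (K * t).
  have /andP[j1 j2] := truncn_itv Kt0.
  have jt : j%:R < K * t.
    rewrite lt_neqAle j1 andbT; apply/eqP => jt; apply: nN; exists j => //.
    by rewrite jt mulrC mulKf ?gt_eqF.
  have jk : (j < k.+1)%N.
    rewrite -(ltr_nat R); apply: lt_le_trans jt _.
    by rewrite -[leRHS]mulr1 ler_pM2l.
  pose i := Ordinal jk.
  have ti : i%:R < K * t < i.+1%:R by rewrite jt j2.
  rewrite (vel_polygon ti) Fhom ?(ltW K0) // (bigD1 i) //= big1 ?adde0 => [|l li].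
    by rewrite /h indicE mem_set ?mulr1 // legP.
  rewrite /h indicE memNset ?mulr0 // legP => /andP[l1 l2].
  move: li; rewrite -(inj_eq val_inj) /= neq_ltn => /orP[li|il].
    have : (l.+1%:R : R) <= j%:R by rewrite ler_nat.
    by lra.
  have : (j.+1%:R : R) <= l%:R by rewrite ler_nat.
  by lra.
rewrite ge0_integral_sum // -sumEFin; apply: lee_sum => i _.
under eq_integral do rewrite /h EFinM.
rewrite ge0_integralZl_EFin //; last first.
  by apply/measurable_EFinP; apply: measurable_indic.
rewrite integral_indic //.
apply: (@le_trans _ _ ((K * F (u i))%:E * lambda (leg i))%E).
  apply: lee_pmul => //; first by rewrite lee_fin.
  by apply: le_measure; rewrite ?inE //; exact: measurableI.
rewrite lebesgue_measure_itv /= lte_fin ltr_pM2r ?invr_gt0 // ltr_nat ltnSn.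
rewrite -EFinB -EFinM lee_fin -mulrBl -natr1 addrC addKr mul1r mulrAC mulfV ?gt_eqF //.
by rewrite mul1r.
Qed.
End polygon.

(** * Length and geodesics *)

Section length.
Context {R : realType} {n : nat}.
Variable F : 'rV[R]_n -> R.
Hypothesis intF : integrand F.
Implicit Types (g r : R -> 'rV[R]_n) (x : 'rV[R]_n).
Notation lambda := (@lebesgue_measure R).

Let Fhom : homogeneous1 F := intF.2.1.
Let Fpos : positive_on_sphere F := intF.2.2.

Lemma I01E : I01 = `[0, 1]%classic :> set R.
Proof. by apply/seteqP; split => t; rewrite /I01 /= in_itv. Qed.

Lemma measurable_I01 : measurable (I01 : set (measurableTypeR R)).
Proof. by rewrite I01E; exact: measurable_itv. Qed.

Lemma ae_I01 (P : R -> Prop) : {ae lambda, forall t, 0 < t < 1 -> P t} ->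
  {ae lambda, forall t, I01 t -> P t}.
Proof.
move=> aeP.
have set1 (c : R) : {ae lambda, forall t, t != c}.
  exists [set c]; split; [exact: measurable_set1|exact: lebesgue_measure_set1|].
  by move=> t /= /negP; rewrite negbK => /eqP.
have FF := ae_filter_ringOfSetsType lambda.
have ae01 : {ae lambda, forall t, t != 0 /\ t != 1} by apply: filterI; exact: set1.
have := @filterI _ (almost_everywhere lambda) FF _ _ aeP ae01.
apply: (@filterS _ _ FF) => t [Pt [t0 t1]] /andP[t0' t1']; apply: Pt.
by rewrite !lt_neqAle t0' t1' t1 eq_sym t0.
Qed.

(** Replaces the velocity by the measurable [H] under every integral, so that comparisons of
    integrals apply. *)
Lemma AC01_velocity g : AC01 g -> exists H : R -> 'rV[R]_n,
  [/\ {ae lambda, forall t, 0 < t < 1 -> vel g t = H t},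
      measurable_fun setT (fun t => (F (H t))%:E),
      lengthF F g = (\int[lambda]_(t in I01) (F (H t))%:E)%E &
      forall x, lambda.-integrable I01 (fun t => (dotp (H t) x)%:E) /\
        (\int[lambda]_(t in I01) (dotp (H t) x)%:E = (dotp (g 1 - g 0) x)%:E)%E].
Proof.
move=> acg; have [H [iH gH vH]] := AC01_ftc acg.
have mF : measurable_fun setT (fun t => (F (H t))%:E).
  apply: measurable_lsc_comp; first exact: intF.1.
  by move=> i; apply/measurable_EFinP; have /integrableP[] := iH i.
exists H; split => //.
  apply: ge0_ae_eq_integralW.
  - exact: measurable_I01.
  - exact: measurable_funS mF.
  - by move=> t _; rewrite lee_fin hom_ge0.
  - by move=> t _; rewrite lee_fin hom_ge0.
  apply: (ae_I01 (P := fun t => (F (vel g t))%:E = (F (H t))%:E)).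
  by apply: (@filterS _ _ (ae_filter_ringOfSetsType lambda) _ _ _ vH) => t h /h ->.
by move=> x; rewrite I01E; exact: AC01_integral_dotp.
Qed.

Lemma integrable_lsc_comp (H : R -> 'rV[R]_n) :
  measurable_fun setT (fun t => (F (H t))%:E) ->
  (\int[lambda]_(t in I01) (F (H t))%:E != +oo)%E ->
  lambda.-integrable I01 (fun t => (F (H t))%:E).
Proof.
move=> mF Hoo; apply/integrableP; split; first exact: measurable_funS mF.
under eq_integral do rewrite gee0_abs ?lee_fin ?hom_ge0 //.
by rewrite ltey.
Qed.

Lemma dotp_le_lengthF g x : AC01 g -> crystal F x ->
  ((dotp (g 1 - g 0) x)%:E <= lengthF F g)%E.
Proof.
move=> /AC01_velocity[H [_ mF -> Hx]] Kx; have [iHx <-] := Hx x.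
(* Infinite length is trivial; finite length makes [F (H t)] integrable and the pointwise bound can
   be integrated. *)
have [->|Hoo] := eqVneq (\int[lambda]_(t in I01) (F (H t))%:E)%E +oo%E.
  by rewrite leey.
apply: le_integral => //; first exact: measurable_I01.
  exact: integrable_lsc_comp.
by move=> t _; rewrite lee_fin dotpC; exact: (crystalP Fhom x).1.
Qed.

(** The difference [F (H t) - dotp (H t) x] is nonnegative with zero integral, hence vanishes almost
    everywhere. *)
Lemma lengthF_eq_ae g x : AC01 g -> crystal F x ->
  lengthF F g = (dotp (g 1 - g 0) x)%:E ->
  {ae lambda, forall t, 0 < t < 1 -> F (vel g t) = dotp (vel g t) x}.
Proof.
move=> acg Kx; have [H [vH mF -> Hx]] := AC01_velocity acg.
have [iHx <-] := Hx x => E.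
have mI := measurable_I01.
have iF : lambda.-integrable I01 (fun t => (F (H t))%:E).
  by apply: integrable_lsc_comp => //; rewrite E (Hx x).2.
have d0 t : (0 <= (F (H t))%:E - (dotp (H t) x)%:E)%E.
  rewrite -EFinB lee_fin subr_ge0 dotpC; exact: (crystalP Fhom x).1.
have iB := integrableB mI iF iHx.
have : (\int[lambda]_(t in I01)
    `|((fun t => (F (H t))%:E) \- (fun t => (dotp (H t) x)%:E)) t| = 0)%E.
  under eq_integral do rewrite gee0_abs //.
  by rewrite integralB // E subee // (Hx x).2.
move/(ae_eq_integral_abs _ mI (measurable_int _ iB)) => aeE.
have FF := ae_filter_ringOfSetsType lambda.
have := @filterI _ (almost_everywhere lambda) FF _ _ vH aeE.
apply: (@filterS _ _ FF) => t [vt Et] t01; rewrite vt //.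
have : I01 t by move/andP: t01 => [/ltW t0 /ltW t1]; apply/andP.
by move/Et => /=; rewrite -EFinB => -[] /eqP; rewrite subr_eq0 => /eqP.
Qed.

Lemma ae_eq_lengthF g x : AC01 g ->
  {ae lambda, forall t, 0 < t < 1 -> F (vel g t) = dotp (vel g t) x} ->
  lengthF F g = (dotp (g 1 - g 0) x)%:E.
Proof.
move=> acg aeE; have [H [vH mF -> Hx]] := AC01_velocity acg.
have [iHx <-] := Hx x; have FF := ae_filter_ringOfSetsType lambda.
apply: ae_eq_integral.
- exact: measurable_I01.
- exact: measurable_funS mF.
- exact: measurable_int iHx.
apply: (ae_I01 (P := fun t => (F (H t))%:E = (dotp (H t) x)%:E)).
have := @filterI _ (almost_everywhere lambda) FF _ _ vH aeE.
by apply: (@filterS _ _ FF) => t [vt Et] t01; rewrite -vt // Et.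
Qed.

Lemma geodesic_lengthF_le g : AC01 g -> geodesic F g ->
  (lengthF F g <= (normF F (g 1 - g 0))%:E)%E.
Proof.
move=> acg geo; apply/lee_addgt0Pr => e e0.
have [s sv sF] := polygon_normF Fhom Fpos (g 1 - g 0) e0.
(* [polygon] has at least one leg while [s] may be empty, so a zero leg is prepended; it costs
   [F 0 = 0]. *)
pose u (i : 'I_(size s).+1) := nth 0 (0 :: s) i.
have sumu (V : zmodType) (f : 'rV[R]_n -> V) : f 0 = 0 ->
    \sum_(i < (size s).+1) f (u i) = \sum_(v <- s) f v.
  move=> f0; transitivity (\sum_(v <- 0 :: s) f v); last by rewrite big_cons f0 add0r.
  by rewrite [RHS](big_nth 0) big_mkord.
apply: le_trans (geo (polygon u (g 0)) _ _ _) _.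
- exact: polygon_AC01.
- exact: polygon0.
- by rewrite polygon1 (sumu _ id) // sv addrC subrK.
apply: le_trans (lengthF_polygon _ _ Fhom Fpos) _.
by rewrite (sumu _ F) ?hom0 // -EFinD lee_fin.
Qed.
End length.

Theorem theorem1p2 (R : realType) (n : nat) (F : 'rV[R]_n -> R)
  (g : R -> 'rV[R]_n) (xbar : 'rV[R]_n) :
  (2 <= n)%N -> integrand F -> AC01 g -> regular g ->
  crystal F xbar -> normF F (g 1 - g 0) = dotp (g 1 - g 0) xbar ->
  [<-> geodesic F g;
       lengthF F g = (normF F (g 1 - g 0))%:E;
       {ae (@lebesgue_measure R), forall t, 0 < t < 1 ->
          Cont F (vel g t) /\ is_supp_hyperplane (crystal F) xbar (vel g t)}].
Proof.
move=> _ intF acg regg Kx normE; have [_ [Fhom Fpos]] := intF.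
have FF := ae_filter_ringOfSetsType (@lebesgue_measure R).
have F_ge v : dotp v xbar <= F v by rewrite dotpC; exact: (crystalP Fhom xbar).1.
tfae.
- move=> geo; apply/eqP; rewrite eq_le (geodesic_lengthF_le intF) //=.
  by rewrite normE; exact: dotp_le_lengthF.
- rewrite normE => /(lengthF_eq_ae intF acg Kx) aeE.
  have := @filterI _ _ FF _ _ regg aeE; apply: (@filterS _ _ FF) => t [v0 vE] t01.
  (* In the chain [dotp v xbar <= Dop F v <= F v] the ends agree, so all three are equal. *)
  have ED : dotp (vel g t) xbar = Dop F (vel g t).
    apply/eqP; rewrite eq_le dotp_le_Dop //= -vE //; exact: Dop_le_id.
  split; first by rewrite /Cont /= vE.
  by apply/is_supp_hyperplaneP => //; exact: v0.
(* Contact and support give [F v = dotp v xbar] along [g], so its length is the lower bound that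
   [xbar] imposes on every competitor. *)
- move=> aeC r acr r0 r1.
  rewrite (ae_eq_lengthF intF (x := xbar) acg).
    by rewrite -r0 -r1; exact: dotp_le_lengthF.
  apply: (@filterS _ _ FF _ _ _ aeC) => t H /H[CF sH].
  have v0 : vel g t != 0 by case: sH.
  by rewrite ((is_supp_hyperplaneP Fhom Fpos v0 Kx).1 sH).
Qed.
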